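(* Let $\sigma_0\in S_n$ be the longest permutation, $\sigma_0(m)=n+1-m$. For all $J,K\in\mathcal I_\lambda$, $$\sum_{I\in\mathcal I_\lambda}h^{p(K)}P(z_I)\,\frac{\widetilde W_{\mathrm{id},J}(z_I,z,h)\,\widetilde W_{\sigma_0,K}(z_I^{-1},z^{-1},h^{-1})}{R(z_I)\,Q(z_I,h)}=\delta_{J,K},$$ where $P(z_I)=\prod_{k<l}\prod_{a\in I_k}\prod_{b\in I_l}(-z_b/z_a)$, $R(z_I)=\prod_{k<l}\prod_{a\in I_k}\prod_{b\in I_l}(1-z_b/z_a)$, $Q(z_I,h)=\prod_{k<l}\prod_{a\in I_k}\prod_{b\in I_l}(1-hz_b/z_a)$, and $\widetilde W_{\sigma_0,K}(z_I^{-1},z^{-1},h^{-1})$ is obtained from the Laurent polynomial $\widetilde W_{\sigma_0,K}(z_I,z,h)$ by substituting $z_i\mapsto z_i^{-1}$ ($i=1..n$) and $h\mapsto h^{-1}$.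
   Context: Fix $N,n$, $\lambda\in\mathbb Z_{\ge0}^N$ with $\sum\lambda_k=n$; $\lambda^{(k)}=\lambda_1+\dots+\lambda_k$, $\lambda^{\{1\}}=\lambda^{(1)}+\dots+\lambda^{(N-1)}$. $\mathcal I_\lambda$ = ordered partitions $I=(I_1,\dots,I_N)$ of $\{1,\dots,n\}$ with $|I_k|=\lambda_k$; $I_1\cup\dots\cup I_k=\{i^{(k)}_1<\dots<i^{(k)}_{\lambda^{(k)}}\}$; $\sigma(I)=(\sigma(I_1),\dots,\sigma(I_N))$. $p(K)$ is the number of inversions (pairs of positions $a<b$ with entries $j_a>j_b$) in the sequence obtained by listing $K_N$ in increasing order, then $K_{N-1}$ in increasing order, ..., then $K_1$ in increasing order. Weight functions: variables $t^{(k)}_a$ ($1\le k\le N-1$, $1\le a\le\lambda^{(k)}$), $z_1,\dots,z_n$, $h$; $t^{(N)}_a=z_a$. $U_I=\prod_{k=1}^{N-1}\prod_{a=1}^{\lambda^{(k)}}\Big(\prod_{c:\,i^{(k+1)}_c<i^{(k)}_a}(1-ht^{(k+1)}_c/t^{(k)}_a)\prod_{c:\,i^{(k+1)}_c>i^{(k)}_a}(1-t^{(k+1)}_c/t^{(k)}_a)\prod_{b=a+1}^{\lambda^{(k)}}\frac{1-ht^{(k)}_b/t^{(k)}_a}{1-t^{(k)}_b/t^{(k)}_a}\Big)$ ($c\in\{1..\lambda^{(k+1)}\}$), $W_I=(1-h)^{\lambda^{\{1\}}}\mathrm{Sym}_{t^{(1)}}\cdots\mathrm{Sym}_{t^{(N-1)}}U_I$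 (sum over all permutations within each group $t^{(k)}$). $W_{\sigma,I}(t,z,h)=W_{\sigma^{-1}(I)}(t,z_{\sigma(1)},\dots,z_{\sigma(n)},h)$. $E(t,h)=\prod_{k=1}^{N-1}\prod_{a,b=1}^{\lambda^{(k)}}(1-ht^{(k)}_b/t^{(k)}_a)$, $\widetilde W_{\sigma,I}=W_{\sigma,I}/E$. $f(z_I,z,h)$: substitution $t^{(k)}_a=z_{i^{(k)}_a}$ (for $\widetilde W$ this yields a Laurent polynomial in $z,h$). *)

(* Defs.v *)
From HB Require Import structures.
From mathcomp Require Import all_boot all_order all_algebra all_fingroup.
Set Implicit Arguments. Unset Strict Implicit. Unset Printing Implicit Defensive.
Import Order.TTheory GRing.Theory Num.Theory.
Local Open Scope ring_scope.

(* Conventions: indices 1..n of the paper are 'I_n (0-based);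
   the block index k = 1..N is the color j : 'I_N with k = j+1.
   An ordered partition I = (I_1,...,I_N) is a coloring I : {ffun 'I_n -> 'I_N},
   I_k = { i | I i = k-1 }. *)

Section WeightFunctions.
Variable F : fieldType.
Variables N n : nat.
Variable lam : 'I_N -> nat.

Definition coloring := {ffun 'I_n -> 'I_N}.

Definition is_part (I : coloring) : bool :=
  [forall j : 'I_N, #|[set i | I i == j]| == lam j].

Definition lamc (k : nat) : nat := (\sum_(j < N | (j < k)%N) lam j)%N.

Definition lam1 : nat := (\sum_(1 <= k < N) lamc k)%N.

(* i^{(k)}_1 < ... < i^{(k)}_{lambda^{(k)}} : increasing list of I_1 u ... u I_k
   (as 0-based nat indices); i^{(k)}_a (1-based a) = nth 0 (ilist I k) (a-1). *)
Definition ilist (I : coloring) (k : nat) : seq nat :=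
  [seq val i | i <- enum 'I_n & (val (I i) < k)%N].

Definition zf (z : 'I_n -> F) (i : nat) : F :=
  match (insub i : option 'I_n) with Some i' => z i' | None => 0 end.

(* variables t^{(k)}_a, with t^{(N)}_a = z_a (a 0-based) *)
Definition tt (t : nat -> nat -> F) (z : 'I_n -> F) (k a : nat) : F :=
  if k == N then zf z a else t k a.

Definition U (I : coloring) (t : nat -> nat -> F) (z : 'I_n -> F) (h : F) : F :=
  \prod_(1 <= k < N) \prod_(0 <= a < lamc k)
    ((\prod_(0 <= c < lamc k.+1)
        (let ic := nth 0%N (ilist I k.+1) c in
         let ia := nth 0%N (ilist I k) a in
         if (ic < ia)%N then 1 - h * tt t z k.+1 c / tt t z k a
         else if (ia < ic)%N then 1 - tt t z k.+1 c / tt t z k a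
         else 1))
     * \prod_(a.+1 <= b < lamc k)
         ((1 - h * tt t z k b / tt t z k a) / (1 - tt t z k b / tt t z k a))).

Definition permlev (k : nat) (s : 'S_(lamc k)) (t : nat -> nat -> F) : nat -> nat -> F :=
  fun k' a =>
    if k' == k then
      match (insub a : option 'I_(lamc k)) with
      | Some a' => t k (val (s a'))
      | None => t k' a
      end
    else t k' a.

Fixpoint symk (m : nat) (f : (nat -> nat -> F) -> F) : (nat -> nat -> F) -> F :=
  match m with
  | 0 => f
  | m'.+1 => fun t => \sum_(s : 'S_(lamc m'.+1)) symk m' f (permlev s t)
  end.

Definition W (I : coloring) (t : nat -> nat -> F) (z : 'I_n -> F) (h : F) : F :=
  (1 - h) ^+ lam1 * symk N.-1 (fun t' => U I t' z h) t.

(* W_{sigma,I}(t,z,h) = W_{sigma^{-1}(I)}(t, z_{sigma(1)},...,z_{sigma(n)}, h);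
   i \in sigma^{-1}(I_k) iff sigma(i) \in I_k. *)
Definition Wsig (sigma : 'S_n) (I : coloring) (t : nat -> nat -> F) (z : 'I_n -> F) (h : F) : F :=
  W [ffun i => I (sigma i)] t (fun i => z (sigma i)) h.

Definition E (t : nat -> nat -> F) (h : F) : F :=
  \prod_(1 <= k < N) \prod_(0 <= a < lamc k) \prod_(0 <= b < lamc k)
     (1 - h * t k b / t k a).

Definition tsub (I : coloring) (z : 'I_n -> F) : nat -> nat -> F :=
  fun k a => zf z (nth 0%N (ilist I k) a).

Definition Wt (sigma : 'S_n) (J I : coloring) (z : 'I_n -> F) (h : F) : F :=
  Wsig sigma J (tsub I z) z h / E (tsub I z) h.

Definition Pf (I : coloring) (z : 'I_n -> F) : F :=
  \prod_(a : 'I_n) \prod_(b : 'I_n | (val (I a) < val (I b))%N) (- (z b / z a)).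
Definition Rf (I : coloring) (z : 'I_n -> F) : F :=
  \prod_(a : 'I_n) \prod_(b : 'I_n | (val (I a) < val (I b))%N) (1 - z b / z a).
Definition Qf (I : coloring) (z : 'I_n -> F) (h : F) : F :=
  \prod_(a : 'I_n) \prod_(b : 'I_n | (val (I a) < val (I b))%N) (1 - h * z b / z a).

Definition seqK (K : coloring) : seq nat :=
  flatten [seq [seq val i | i <- enum 'I_n & K i == j] | j <- rev (enum 'I_N)].
Definition inversions (s : seq nat) : nat :=
  (\sum_(0 <= a < size s) \sum_(a.+1 <= b < size s)
      (nth 0 s b < nth 0 s a)%N)%N.
Definition pinv (K : coloring) : nat := inversions (seqK K).

End WeightFunctions.

Definition sigma0 (n : nat) : 'S_n := perm (@rev_ord_inj n).

(* Main.v *)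
(* Index the variables t^(k) by the positions of color < k instead of by their
   ranks. Then W_I is a nested sum over injections of the sets I_1 u ... u I_k
   into those of the evaluation point, and exchanging two adjacent positions
   p, q never relabels a variable. For s = (p q), the values of W_I and W_{sI}
   at (t, z o s) are combinations of their values at (t, z), with the entries
   of the trigonometric R-matrix as coefficients: level by level, this is an
   identity between rational functions of two t's and two z's. The dual
   functions satisfy the transposed relations, and the sum over I is unchanged
   when (z, I) is replaced by (z o s, I o s), so orthonormality passes from J
   to sJ. For a weakly increasing J, finally, W_J vanishes at every z_I with
   I <> J and the dual function of K vanishes at z_J unless K = J, which leaves
   one explicit term. *)
Require Import Defs.
From mathcomp Require Import all_boot all_order all_algebra all_fingroup.
From mathcomp Require Import zify ring.
Set Implicit Arguments.
Unset Strict Implicit.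
Unset Printing Implicit Defensive.
Import Order.TTheory GRing.Theory Num.Theory.
Local Open Scope ring_scope.

(* Reindexing by sig would only show that the sums agree up to a factor 2;
   pairing the elements of each orbit also covers characteristic 2. *)
Lemma eq_sumr_involution (V : nmodType) (T : finType) (P : pred T)
    (sig : T -> T) (G H : T -> V) :
  involutive sig -> (forall x, P (sig x) = P x) ->
  (forall x, P x -> sig x != x) ->
  (forall x, P x -> G x + G (sig x) = H x + H (sig x)) ->
  \sum_(x | P x) G x = \sum_(x | P x) H x.
Proof.
move=> sigK Psig sig_neq eqGH.
pose first x := (enum_rank x < enum_rank (sig x))%N.
have sum_orbits (K : T -> V) :
    \sum_(x | P x) K x = \sum_(x | P x && first x) (K x + K (sig x)).
  rewrite (bigID first) big_split; congr (_ + _) => /=.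
  rewrite (reindex_inj (inv_inj sigK)); apply: eq_bigl => x.
  rewrite Psig /first sigK -leqNgt leq_eqVlt; apply: andb_id2l => Px.
  by rewrite val_eqE (inj_eq enum_rank_inj) eq_sym (negPf (sig_neq x Px)).
by rewrite !sum_orbits; apply: eq_bigr => x /andP[Px _]; apply: eqGH.
Qed.

Lemma subr1_div_eq0 (F : fieldType) (a b : F) : b != 0 ->
  (1 - a / b == 0) = (a == b).
Proof.
move=> b_neq0; rewrite subr_eq0 -(divff b_neq0).
by rewrite (inj_eq (mulIf _)) ?invr_eq0 // eq_sym.
Qed.

Section Pullback.
Variables (aT : finType) (R : Type).
Implicit Types (u v : {perm aT}) (f : {ffun aT -> R}).

Definition pullback u f : {ffun aT -> R} := [ffun i => f (u i)].

Lemma pullbackM u v f : pullback u (pullback v f) = pullback (u * v)%g f.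
Proof. by apply/ffunP=> i; rewrite !ffunE permM. Qed.

Lemma pullback1 f : pullback 1%g f = f.
Proof. by apply/ffunP=> i; rewrite ffunE perm1. Qed.

Lemma pullbackK u : cancel (pullback u) (pullback u^-1%g).
Proof. by move=> f; rewrite pullbackM mulVg pullback1. Qed.

Lemma pullback_inj u : injective (pullback u).
Proof. exact: can_inj (pullbackK u). Qed.

Lemma pullback_tpermK i j : involutive (pullback (tperm i j)).
Proof. by move=> f; rewrite pullbackM tperm2 pullback1. Qed.

End Pullback.

Lemma preim_tperm_id (T : finType) (p q : T) (A : {set T}) :
  (p \in A) = (q \in A) -> tperm p q @^-1: A = A.
Proof.
by move=> eq_pq; apply/setP=> i; rewrite inE; case: tpermP => [->|->|].
Qed.

(** * Partial injections *)

Section PartialInjections.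
Variables aT rT : finType.
Implicit Types (A : {set aT}) (D : {set rT}) (f : {ffun aT -> option rT}).

Definition partial_inj A D f : bool :=
  (f \in pffun_on None A (Some @: D)) && dinjectiveb f A.

Lemma partial_injP A D f : reflect
  [/\ forall i, i \notin A -> f i = None,
      forall i, i \in A -> exists2 d, d \in D & f i = Some d &
      {in A &, injective f}] (partial_inj A D f).
Proof.
apply: (iffP andP) => [[/pfamilyP[suppA fD] /dinjectiveP f_inj]
                      |[f_none fD f_inj]]; split=> //.
- by move=> i; apply: contraNeq; apply: (subsetP suppA).
- by move=> i /fD/imsetP.
- apply/pfamilyP; split=> [|i /fD[d dD ->]]; last exact: imset_f.
  by apply/subsetP=> i; apply: contraNT => /f_none ->.
- exact/dinjectiveP.
Qed.

Lemma partial_inj_pullback (u : {perm aT}) A D f :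
  partial_inj (u @^-1: A) D (pullback u f) = partial_inj A D f.
Proof.
apply/partial_injP/partial_injP => -[f_none fD f_inj]; split.
- by move=> i iA; move: (f_none (u^-1%g i)); rewrite inE ffunE permKV => ->.
- by move=> i iA; move: (fD (u^-1%g i)); rewrite inE ffunE permKV; apply.
- move=> i j iA jA eq_f; apply: (@perm_inj _ u^-1%g).
  by apply: f_inj; rewrite ?inE ?ffunE ?permKV.
- by move=> i; rewrite inE ffunE => /f_none.
- by move=> i; rewrite inE ffunE => /fD.
- by move=> i j; rewrite !inE !ffunE => iA jA /f_inj-/(_ iA jA)/perm_inj.
Qed.

Lemma partial_inj_omap (u : {perm rT}) A D f :
  partial_inj A D [ffun i => omap u (f i)] = partial_inj A (u @^-1: D) f.
Proof.
have omap_u_inj : injective (omap u) by move=> [a|] [b|] // [] /perm_inj ->.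
apply/partial_injP/partial_injP => -[f_none fD f_inj]; split.
- by move=> i /f_none; rewrite ffunE; case: (f i).
- move=> i /fD[d dD]; rewrite ffunE; case: (f i) => //= e [ed].
  by exists e; rewrite // inE ed.
- by move=> i j iA jA eq_f; apply: f_inj; rewrite // !ffunE eq_f.
- by move=> i /f_none; rewrite ffunE => ->.
- by move=> i /fD[d]; rewrite inE ffunE => uD ->; exists (u d).
- by move=> i j iA jA; rewrite !ffunE => /omap_u_inj; apply: f_inj.
Qed.

Lemma partial_inj_onto A D f d : #|A| = #|D| -> partial_inj A D f ->
  d \in D -> exists2 i, i \in A & f i = Some d.
Proof.
move=> cardAD /partial_injP[_ fD f_inj] dD.
have sub_fD : f @: A \subset Some @: D.
  by apply/subsetP=> _ /imsetP[i /fD[e eD ->] ->]; apply: imset_f.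
have /eqP eq_fD : f @: A == Some @: D.
  by rewrite eqEcard sub_fD !card_in_imset ?cardAD ?leqnn // => e e' _ _ [].
have /imsetP[i iA fi] : Some d \in f @: A by rewrite eq_fD imset_f.
by exists i.
Qed.

Section ReindexPerm.
Variables (I : finType) (x : I -> aT) (d : I -> rT).
Hypotheses (x_inj : injective x) (d_inj : injective d).

Definition pinj_of_perm (s : {perm I}) : {ffun aT -> option rT} :=
  [ffun i => omap (d \o s) [pick a | x a == i]].

Lemma pinj_of_permE s a : pinj_of_perm s (x a) = Some (d (s a)).
Proof.
rewrite ffunE; case: pickP => [b /eqP/x_inj -> //|/(_ a)].
by rewrite eqxx.
Qed.

Lemma pinj_of_perm_inj : injective pinj_of_perm.
Proof.
move=> s s' eq_ss; apply/permP=> a; apply: d_inj.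
by have [] : Some (d (s a)) = Some (d (s' a)) by rewrite -!pinj_of_permE eq_ss.
Qed.

Lemma pinj_of_permP f :
  reflect (exists s, f = pinj_of_perm s) (partial_inj (x @: I) (d @: I) f).
Proof.
apply: (iffP (partial_injP _ _ _)) => [[f_none fD f_inj]|[s ->]].
  have /fin_all_exists[r fr] a : exists b, f (x a) = Some (d b).
    have [|_ /imsetP[b _ ->] ->] := fD (x a); first exact: imset_f.
    by exists b.
  have r_inj : injective r.
    move=> a b eq_r; apply: x_inj; apply: f_inj; rewrite ?imset_f //.
    by rewrite !fr eq_r.
  exists (perm r_inj); apply/ffunP=> i.
  have [/imsetP[a _ ->]|iX] := boolP (i \in x @: I).
    by rewrite pinj_of_permE permE fr.
  rewrite f_none // ffunE; case: pickP => // a /eqP xa.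
  by rewrite -xa imset_f in iX.
split.
- move=> i iX; rewrite ffunE; case: pickP => // a /eqP xa.
  by rewrite -xa imset_f in iX.
- move=> _ /imsetP[a _ ->]; rewrite pinj_of_permE.
  by exists (d (s a)); rewrite ?imset_f.
- move=> _ _ /imsetP[a _ ->] /imsetP[b _ ->]; rewrite !pinj_of_permE.
  by case=> /d_inj/perm_inj ->.
Qed.

Lemma big_partial_inj (R : Type) (idx : R) (op : Monoid.com_law idx)
    (G : {ffun aT -> option rT} -> R) :
  \big[op/idx]_(f | partial_inj (x @: I) (d @: I) f) G f
  = \big[op/idx]_s G (pinj_of_perm s).
Proof.
transitivity (\big[op/idx]_(f in pinj_of_perm @: {perm I}) G f).
  apply: eq_bigl => f.
  by apply/pinj_of_permP/imsetP => [[s ->]|[s _ ->]]; exists s.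
by rewrite big_imset // => s s' _ _ /pinj_of_perm_inj.
Qed.

End ReindexPerm.

Section PartialValue.
Variable V : nmodType.
Implicit Type z : rT -> V.

Definition pvalue z f (i : aT) : V := oapp z 0 (f i).

Lemma pvalue_pullback z u f : pvalue z (pullback u f) =1 pvalue z f \o u.
Proof. by move=> i; rewrite /pvalue ffunE. Qed.

Lemma pvalue_perm z (u : {perm rT}) f :
  pvalue (z \o u) f =1 pvalue z [ffun i => omap u (f i)].
Proof. by move=> i; rewrite /pvalue ffunE; case: (f i). Qed.

End PartialValue.

End PartialInjections.

Section DeflationaryInjections.
Variable n : nat.
Implicit Types (A D : {set 'I_n}) (f : {ffun 'I_n -> option 'I_n}).

Definition partial_id A : {ffun 'I_n -> option 'I_n} :=
  [ffun i => if i \in A then Some i else None].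

Lemma partial_idP A : partial_inj A A (partial_id A).
Proof.
apply/partial_injP; split=> [i /negPf iA|i iA|i j iA jA]; rewrite !ffunE ?iA //.
  by exists i.
by rewrite jA => -[].
Qed.

Definition deflationary A f : Prop :=
  forall i d : 'I_n, i \in A -> f i = Some d -> (d <= i)%N.

Lemma deflationary_eq_id A f :
  partial_inj A A f -> deflationary A f -> f = partial_id A.
Proof.
move=> /partial_injP[f_none fA f_inj] f_le; apply/ffunP=> i; rewrite ffunE.
case: ifP => [|/negbT/f_none//]; have [m] := ubnP (i : nat).
elim: m i => // m IH i; rewrite ltnS => im iA; have [d dA fi] := fA i iA.
have := f_le i d iA fi; rewrite leq_eqVlt => /predU1P[/val_inj eq_di|lt_di].
  by rewrite fi eq_di.
have eq_di : d = i by apply: f_inj; rewrite // fi IH // (leq_trans lt_di).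
by rewrite eq_di ltnn in lt_di.
Qed.

Definition down_closed A : Prop :=
  forall i d : 'I_n, i \in A -> (d <= i)%N -> d \in A.

Definition up_closed A : Prop :=
  forall i d : 'I_n, d \in A -> (d <= i)%N -> i \in A.

Lemma deflationary_eq_domain A D f : #|A| = #|D| ->
  partial_inj A D f -> deflationary A f -> down_closed A \/ up_closed D ->
  A = D.
Proof.
move=> cardAD f_pinj f_le [A_down|D_up]; apply/eqP.
  rewrite eq_sym eqEcard cardAD leqnn andbT; apply/subsetP=> d dD.
  have [i iA fi] := partial_inj_onto cardAD f_pinj dD.
  exact: A_down (f_le i d iA fi).
have [_ fD _] := partial_injP _ _ _ f_pinj.
rewrite eqEcard cardAD leqnn andbT; apply/subsetP=> i iA.
by have [d dD fi] := fD i iA; apply: D_up dD (f_le i d iA fi).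
Qed.

End DeflationaryInjections.

(** * One level of the weight function *)

Section LevelFactor.
Variables (F : fieldType) (n : nat) (h : F).
Implicit Types (A B : {set 'I_n}) (t y : 'I_n -> F) (i c : 'I_n).

Definition cross_factor (i c : nat) (u v : F) : F :=
  if (c < i)%N then 1 - h * v / u else if (i < c)%N then 1 - v / u else 1.

Definition inner_factor (u v : F) : F := (1 - h * v / u) / (1 - v / u).

(* The factor of U_I with k fixed: A and B are the sets of positions of color
   < k and < k + 1, t = t^(k) and y = t^(k+1), both indexed by positions. *)
Definition level_factor A B t y : F :=
  (\prod_(x | (x.1 \in A) && (x.2 \in B)) cross_factor x.1 x.2 (t x.1) (y x.2))
  * \prod_(x | [&& x.1 \in A, x.2 \in A & (x.1 < x.2)%N])
      inner_factor (t x.1) (t x.2).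

Lemma eq_in_level_factor A B t t' y y' : {in A, t =1 t'} -> {in B, y =1 y'} ->
  level_factor A B t y = level_factor A B t' y'.
Proof.
move=> eq_t eq_y; congr (_ * _); apply: eq_bigr => x.
  by case/andP=> xA xB; rewrite eq_t ?eq_y.
by case/and3P=> x1A x2A _; rewrite !eq_t.
Qed.

Lemma eq_level_factor A B t t' y : t =1 t' ->
  level_factor A B t y = level_factor A B t' y.
Proof. by move=> eq_t; apply: eq_in_level_factor (in1W eq_t) _. Qed.

Lemma level_factor_rows A B t y :
  level_factor A B t y =
  \prod_(i in A) ((\prod_(c in B) cross_factor i c (t i) (y c))
                  * \prod_(c in A | (i < c)%N) inner_factor (t i) (t c)).
Proof.
rewrite big_split /=; congr (_ * _).
  exact/esym/(pair_big_dep (mem A) (fun _ => mem B)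
                (fun i c => cross_factor i c (t i) (y c))).
exact/esym/(pair_big_dep (mem A) (fun i c => (c \in A) && (i < c)%N)
              (fun i c => inner_factor (t i) (t c))).
Qed.

Lemma level_factor_eq0 A B t y i c : i \in A -> c \in B -> (i < c)%N ->
  t i != 0 -> y c = t i -> level_factor A B t y = 0.
Proof.
move=> iA cB lt_ic ti_neq0 eq_yt; rewrite /level_factor (bigD1 (i, c)) ?iA //=.
by rewrite /cross_factor lt_ic ltnNge ltnW //= eq_yt divff // subrr !mul0r.
Qed.

End LevelFactor.

Section AdjacentPositions.
Variables (F : fieldType) (n : nat) (h : F) (p q : 'I_n).
Hypothesis pq : q = p.+1 :> nat.
Implicit Types (A B : {set 'I_n}) (t y : 'I_n -> F) (i c : 'I_n).
Local Notation s := (tperm p q).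

Lemma adjacent_neq : p != q.
Proof. by rewrite -val_eqE /= pq ltn_eqF. Qed.

Definition swapped_pair (x : 'I_n * 'I_n) : bool :=
  (x.1 \in pred2 p q) && (x.2 \in pred2 p q).

Lemma tperm_pred2 i : (s i \in pred2 p q) = (i \in pred2 p q).
Proof. by rewrite !inE !(canF_eq (tpermK p q)) tpermL tpermR orbC. Qed.

Lemma swapped_pair_tperml i c : swapped_pair (s i, c) = swapped_pair (i, c).
Proof. by rewrite /swapped_pair /= tperm_pred2. Qed.

Lemma swapped_pair_tpermr i c : swapped_pair (i, s c) = swapped_pair (i, c).
Proof. by rewrite /swapped_pair /= tperm_pred2. Qed.

Lemma swapped_pairC i c : swapped_pair (i, c) = swapped_pair (c, i).
Proof. exact: andbC. Qed.

Lemma ltn_tperml i c : ~~ swapped_pair (i, c) -> (s i < c)%N = (i < c)%N.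
Proof.
rewrite /swapped_pair !inE -!val_eqE /= pq.
by case: tpermP => [->|->|_ _ //]; rewrite ?pq; lia.
Qed.

Lemma ltn_tpermr i c : ~~ swapped_pair (i, c) -> (i < s c)%N = (i < c)%N.
Proof.
rewrite /swapped_pair !inE -!val_eqE /= pq.
by case: tpermP => [->|->|_ _ //]; rewrite ?pq; lia.
Qed.

Lemma ltn_tperm i c : ~~ swapped_pair (i, c) -> (s i < s c)%N = (i < c)%N.
Proof.
by move=> ns; rewrite ltn_tperml ?ltn_tpermr // swapped_pair_tpermr.
Qed.

Definition common_cross_factor A B t y : F :=
  \prod_(x | [&& x.1 \in A, x.2 \in B & ~~ swapped_pair x])
    cross_factor h x.1 x.2 (t x.1) (y x.2).

Definition common_inner_factor A t : F :=
  \prod_(x | [&& x.1 \in A, x.2 \in A, (x.1 < x.2)%N & ~~ swapped_pair x])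
    inner_factor h (t x.1) (t x.2).

Definition common_factor A B t y : F :=
  common_cross_factor A B t y * common_inner_factor A t.

Lemma common_cross_factor_tperml A B t y :
  common_cross_factor (s @^-1: A) B (t \o s) y = common_cross_factor A B t y.
Proof.
pose sl (x : 'I_n * 'I_n) := (s x.1, x.2).
have slK : involutive sl by case=> i c; rewrite /sl tpermK.
rewrite /common_cross_factor (reindex_inj (inv_inj slK)).
apply: eq_big => [[i c]|[i c] /and3P[_ _ ns]] /=.
  by rewrite in_set tpermK swapped_pair_tperml.
rewrite swapped_pair_tperml in ns.
by rewrite /cross_factor tpermK ltn_tperml ?ltn_tpermr // swapped_pairC.
Qed.

Lemma common_cross_factor_tpermr A B t y :
  common_cross_factor A (s @^-1: B) t (y \o s) = common_cross_factor A B t y.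
Proof.
pose sr (x : 'I_n * 'I_n) := (x.1, s x.2).
have srK : involutive sr by case=> i c; rewrite /sr tpermK.
rewrite /common_cross_factor (reindex_inj (inv_inj srK)).
apply: eq_big => [[i c]|[i c] /and3P[_ _ ns]] /=.
  by rewrite in_set tpermK swapped_pair_tpermr.
rewrite swapped_pair_tpermr in ns.
by rewrite /cross_factor tpermK ltn_tpermr ?ltn_tperml // swapped_pairC.
Qed.

Lemma common_inner_factor_tperm A t :
  common_inner_factor (s @^-1: A) (t \o s) = common_inner_factor A t.
Proof.
pose ss (x : 'I_n * 'I_n) := (s x.1, s x.2).
have ssK : involutive ss by case=> i c; rewrite /ss !tpermK.
rewrite /common_inner_factor (reindex_inj (inv_inj ssK)).
apply: eq_big => [[i c]|[i c] _] /=; last by rewrite !tpermK.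
rewrite !in_set !tpermK swapped_pair_tperml swapped_pair_tpermr.
by case: (boolP (swapped_pair _)) => [|ns]; rewrite ?andbF ?ltn_tperm.
Qed.

Lemma common_factor_tperml A B t y :
  common_factor (s @^-1: A) B (t \o s) y = common_factor A B t y.
Proof.
by rewrite /common_factor common_cross_factor_tperml common_inner_factor_tperm.
Qed.

Lemma common_factor_tpermr A B t y :
  common_factor A (s @^-1: B) t (y \o s) = common_factor A B t y.
Proof. by rewrite /common_factor common_cross_factor_tpermr. Qed.

Lemma common_factor_tperml_id A B t y : (p \in A) = (q \in A) ->
  common_factor A B (t \o s) y = common_factor A B t y.
Proof.
by move=> pqA; rewrite -{1}(preim_tperm_id pqA) common_factor_tperml.
Qed.

Lemma common_factor_tpermr_id A B t y : (p \in B) = (q \in B) ->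
  common_factor A B t (y \o s) = common_factor A B t y.
Proof.
by move=> pqB; rewrite -{1}(preim_tperm_id pqB) common_factor_tpermr.
Qed.

Lemma big_swapped_pair (G : 'I_n * 'I_n -> F) :
  \prod_(x | swapped_pair x) G x
  = (G (p, p) * G (p, q)) * (G (q, p) * G (q, q)).
Proof.
have prod_pq (H : 'I_n -> F) : \prod_(i in pred2 p q) H i = H p * H q.
  rewrite (bigD1 p) ?inE ?eqxx //= (big_pred1 q) // => i.
  rewrite !inE andb_orl andbN /= andb_idr // => /eqP ->.
  by rewrite eq_sym adjacent_neq.
transitivity (\prod_(i in pred2 p q) \prod_(c in pred2 p q) G (i, c)).
  by rewrite pair_big; apply: eq_bigr => -[].
by rewrite !prod_pq.
Qed.

Lemma level_factorE A B t y :
  level_factor h A B t y = common_factor A B t y *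
    ((if (p \in A) && (q \in B) then 1 - y q / t p else 1)
     * (if (p \in A) && (q \in A) then inner_factor h (t p) (t q) else 1)
     * (if (q \in A) && (p \in B) then 1 - h * y p / t q else 1)).
Proof.
have ltpq : (p < q)%N by rewrite pq.
have ltqp : (q < p)%N = false by rewrite ltnNge ltnW.
rewrite /level_factor (bigID swapped_pair) [X in _ * X](bigID swapped_pair).
rewrite /= mulrACA mulrC; congr (_ * _).
  by congr (_ * _); apply: eq_bigl => x; rewrite -!andbA.
rewrite big_mkcondl [X in _ * X]big_mkcondl !big_swapped_pair /=.
rewrite /cross_factor !ltnn ltpq ltqp !andbF !if_same andbT.
by rewrite !mul1r !mulr1 mulrAC.
Qed.

Lemma level_factor_pullback A B t y :
  A \subset B -> ~~ ((p \in B) && (q \in B)) ->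
  level_factor h (s @^-1: A) (s @^-1: B) (t \o s) (y \o s)
  = level_factor h A B t y.
Proof.
move=> /subsetP sAB npqB.
have no_swapped_factor (b1 b2 b3 : bool) (u1 u2 u3 : F) :
    ~~ b1 -> ~~ b2 -> ~~ b3 ->
    (if b1 then u1 else 1) * (if b2 then u2 else 1) * (if b3 then u3 else 1)
    = 1.
  by move=> /negPf-> /negPf-> /negPf->; rewrite !mulr1.
rewrite !level_factorE !no_swapped_factor ?inE ?tpermL ?tpermR.
- by rewrite common_factor_tperml common_factor_tpermr.
all: apply: contra npqB => /andP[hA hB].
all: by rewrite ?hA ?hB ?(sAB _ hA) ?(sAB _ hB).
Qed.

End AdjacentPositions.

(** * Nested sums over partial injections *)

Section NestedSum.
Variables (F : fieldType) (n : nat) (T : finType) (h : F).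
Implicit Types (A : nat -> {set 'I_n}) (D : nat -> {set T}).
Implicit Types (z : T -> F) (y : 'I_n -> F) (f : {ffun 'I_n -> option T}).

(* The sum over t^(1), ..., t^(k) for t^(k+1) = y: the values of t^(j) at the
   positions in A j are the z d, d in D j, in all possible orders. *)
Fixpoint nested_sum A D z (k : nat) y : F :=
  if k is k'.+1 then
    \sum_(f | partial_inj (A k) (D k) f)
      level_factor h (A k) (A k.+1) (pvalue z f) y
        * nested_sum A D z k' (pvalue z f)
  else 1.

Lemma nested_sumS A D z k y :
  nested_sum A D z k.+1 y = \sum_(f | partial_inj (A k.+1) (D k.+1) f)
    level_factor h (A k.+1) (A k.+2) (pvalue z f) y
      * nested_sum A D z k (pvalue z f).
Proof. by []. Qed.

Lemma eq_in_nested_sum A D z k y y' : {in A k.+1, y =1 y'} ->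
  nested_sum A D z k y = nested_sum A D z k y'.
Proof.
case: k => // k eq_y; apply: eq_bigr => f _; congr (_ * _).
exact: eq_in_level_factor.
Qed.

Lemma eq_nested_sum A D z k y y' : y =1 y' ->
  nested_sum A D z k y = nested_sum A D z k y'.
Proof. by move=> eq_y; apply: eq_in_nested_sum (in1W eq_y). Qed.

Lemma nested_sum_pullback (p q : 'I_n) A A' D z k y :
  q = p.+1 :> nat -> (forall j, A' j = tperm p q @^-1: A j) ->
  (forall j, A j \subset A j.+1) ->
  ~~ ((p \in A k.+1) && (q \in A k.+1)) ->
  nested_sum A' D z k (y \o tperm p q) = nested_sum A D z k y.
Proof.
move=> pq eqA subA; elim: k y => [|k IH] y npq //=.
rewrite !eqA (reindex_inj (@pullback_inj _ _ (tperm p q))).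
under eq_bigl => f do rewrite partial_inj_pullback.
apply: eq_bigr => f _; have eq_f := pvalue_pullback z (tperm p q) f.
rewrite (eq_level_factor _ _ _ _ eq_f) level_factor_pullback //.
rewrite (eq_nested_sum _ _ _ _ eq_f) IH //.
by apply: contra npq => /andP[pA qA]; rewrite !(subsetP (subA k.+1)).
Qed.

Lemma nested_sum_perm (u : {perm T}) A D D' z k y :
  (forall j, D' j = u @^-1: D j) ->
  nested_sum A D' (z \o u) k y = nested_sum A D z k y.
Proof.
move=> eqD; elim: k y => [|k IH] y //=.
pose relabel (v : {perm T}) (f : {ffun 'I_n -> option T}) :=
  [ffun i => omap v (f i)].
have relabelK : cancel (relabel u) (relabel u^-1%g).
  move=> f; apply/ffunP=> i; rewrite !ffunE.
  by case: (f i) => //= d; rewrite permK.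
rewrite [RHS](reindex_inj (can_inj relabelK)) eqD.
under [RHS]eq_bigl => f do rewrite partial_inj_omap.
apply: eq_bigr => f _; have eq_f := pvalue_perm z u f.
by rewrite (eq_level_factor _ _ _ _ eq_f) IH (eq_nested_sum _ _ _ _ eq_f).
Qed.

End NestedSum.

(** * Colorings *)

Section Colorings.
Variables (N n : nat) (lam : 'I_N -> nat).
Implicit Types (X : coloring N n) (u : {perm 'I_n}).

(* I_1 u ... u I_k *)
Definition sublevel X (k : nat) : {set 'I_n} := [set i | (X i < k)%N].

Lemma sublevelS X k : sublevel X k \subset sublevel X k.+1.
Proof. by apply/subsetP=> i; rewrite !inE => /ltnW. Qed.

Lemma sublevel_pullback X u k :
  sublevel (pullback u X) k = u @^-1: sublevel X k.
Proof. by apply/setP=> i; rewrite !inE ffunE. Qed.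

Lemma card_sublevel X k : is_part lam X -> #|sublevel X k| = lamc lam k.
Proof.
move=> /forallP partX.
rewrite -sum1_card (partition_big X (fun j : 'I_N => (j < k)%N)) => [|i].
  apply: eq_bigr => j jk; rewrite -(eqP (partX j)) -sum1_card.
  apply: eq_bigl => i.
  by rewrite !inE; case: eqP => [->|]; rewrite ?jk ?andbF.
by rewrite inE.
Qed.

Lemma big_sublevelD (R : Type) (idx : R) (op : Monoid.com_law idx) X
    (G : 'I_n -> 'I_n -> R) :
  \big[op/idx]_(1 <= k < N) \big[op/idx]_(i in sublevel X k)
     \big[op/idx]_(c in sublevel X k.+1 :\: sublevel X k) G i c
  = \big[op/idx]_i \big[op/idx]_(c | (X i < X c)%N) G i c.
Proof.
have in_level k c :
    (c \in sublevel X k.+1 :\: sublevel X k) = (k == X c :> nat).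
  by rewrite !inE -leqNgt ltnS -eqn_leq.
under eq_bigr => k _ do under eq_bigr => i _ do
  under eq_bigl => c do rewrite in_level.
rewrite (exchange_big_dep xpredT) //=; apply: eq_bigr => i _.
rewrite (exchange_big_dep (fun c => (X i < X c)%N)) /= => [|k c].
  apply: eq_bigr => c Xic.
  rewrite (eq_bigl (fun k => k == X c :> nat)) => [|k].
    by rewrite big_nat1_eq ltn_ord (leq_ltn_trans _ Xic).
  by rewrite inE andb_idl // => /eqP->.
by rewrite inE => ik /eqP <-.
Qed.

Lemma big_pullback_ltn (R : Type) (idx : R) (op : Monoid.com_law idx) u X
    (G : 'I_n -> 'I_n -> R) :
  \big[op/idx]_a \big[op/idx]_(b | (pullback u X a < pullback u X b)%N)
     G (u a) (u b)
  = \big[op/idx]_a \big[op/idx]_(b | (X a < X b)%N) G a b.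
Proof.
rewrite [RHS](reindex_inj (@perm_inj _ u)); apply: eq_bigr => a _.
rewrite [RHS](reindex_inj (@perm_inj _ u)); apply: eq_bigl => b.
by rewrite !ffunE.
Qed.

Lemma is_part_pullback u X : is_part lam (pullback u X) = is_part lam X.
Proof.
apply: eq_forallb => j; congr (_ == _).
rewrite -[RHS](card_preimset _ (@perm_inj _ u)).
by congr #|pred_of_set _|; apply/setP=> i; rewrite !inE ffunE.
Qed.

End Colorings.

(** * Exchange relation *)

Section ExchangeCoefficients.
Variable F : fieldType.
Implicit Types (h u v t x y w : F) (a b : nat).

(* For colors a, b carrying the parameters u, v, these are the entries of the
   trigonometric R-matrix, cleared of the denominator v - h u. *)
Definition exchange_diag h a b u v : F :=
  if (a < b)%N then (1 - h) * u
  else if (b < a)%N then (1 - h) * v else v - h * u.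

Definition exchange_off h a b u v : F :=
  if (a < b)%N then v - u else if (b < a)%N then h * (v - u) else 0.

Definition pair_factor h t1 t2 x y : F :=
  (1 - y / t1) * inner_factor h t1 t2 * (1 - h * x / t2).

Lemma pair_factor_exchange h a b t1 t2 x y w1 w2 w1' w2' :
  t1 != 0 -> t2 != 0 -> t1 != t2 -> h * t1 != t2 ->
  (t2 - h * t1) * w1'
    = exchange_diag h a b t1 t2 * w1 + exchange_off h a b t1 t2 * w2 ->
  (t2 - h * t1) * w2'
    = exchange_diag h b a t1 t2 * w2 + exchange_off h b a t1 t2 * w1 ->
  (y - h * x)
    * (pair_factor h t1 t2 y x * w1 + pair_factor h t2 t1 y x * w1')
  = exchange_diag h a b x y
      * (pair_factor h t1 t2 x y * w1 + pair_factor h t2 t1 x y * w1')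
    + exchange_off h a b x y
      * (pair_factor h t1 t2 x y * w2 + pair_factor h t2 t1 x y * w2').
Proof.
move=> t1_neq0 t2_neq0 neq_t12 neq_ht12 exch1 exch2.
have den_neq0 : t2 - h * t1 != 0 by rewrite subr_eq0 eq_sym.
have neq_t21 : t2 - t1 != 0 by rewrite subr_eq0 eq_sym.
rewrite -subr_eq0 in neq_t12.
have solve w e : (t2 - h * t1) * w = e -> w = e / (t2 - h * t1).
  by move=> <-; rewrite mulrC mulKf.
rewrite (solve _ _ exch1) (solve _ _ exch2).
rewrite /exchange_diag /exchange_off /pair_factor /inner_factor.
case: (ltngtP a b) => _;
  by field; rewrite t1_neq0 t2_neq0 den_neq0 neq_t12 neq_t21.
Qed.

End ExchangeCoefficients.

Definition admissible (F : fieldType) (T : Type) (g : F) (z : T -> F) : Prop :=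
  [/\ forall i, z i != 0, injective z & forall i j, g * z i != z j].

Section Exchange.
Variables (F : fieldType) (N n : nat) (p q : 'I_n).
Hypothesis pq : q = p.+1 :> nat.
Implicit Types (X : coloring N n) (y : 'I_n -> F).
Local Notation s := (tperm p q).

Definition exchange_relation (h : F)
    (w : coloring N n -> ('I_n -> F) -> F) X y : Prop :=
  (y q - h * y p) * w X (y \o s)
  = exchange_diag h (X p) (X q) (y p) (y q) * w X y
    + exchange_off h (X p) (X q) (y p) (y q) * w (pullback s X) y.

(* The matrix of coefficients is transposed, and y is exchanged with y o s. *)
Definition adjoint_exchange_relation (h : F)
    (w : coloring N n -> ('I_n -> F) -> F) X y : Prop :=
  (y q - h * y p) * w X y
  = exchange_diag h (X p) (X q) (y p) (y q) * w X (y \o s)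
    + exchange_off h (X q) (X p) (y p) (y q) * w (pullback s X) (y \o s).

Variables (T : finType) (h : F) (z : T -> F) (D : nat -> {set T}).
Hypothesis z_adm : admissible h z.

Local Notation wsum k := (fun X => nested_sum h (sublevel X) D z k).
Local Notation common X k f y :=
  (common_factor h p q (sublevel X k) (sublevel X k.+1) (pvalue z f) y).

Lemma pvalue_admissible (A : {set 'I_n}) (C : {set T}) f :
  partial_inj A C f -> p \in A -> q \in A ->
  [/\ pvalue z f p != 0, pvalue z f q != 0, pvalue z f p != pvalue z f q &
      h * pvalue z f p != pvalue z f q].
Proof.
have [z_neq0 z_inj hz] := z_adm; move=> /partial_injP[_ fC f_inj] pA qA.
have [d _ fp] := fC p pA; have [e _ fq] := fC q qA.
rewrite /pvalue fp fq; split=> //=.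
apply: contra (adjacent_neq pq) => /eqP/z_inj eq_de.
by apply/eqP; apply: f_inj; rewrite // fp fq eq_de.
Qed.

Lemma pullback_tperm_neq (A : {set 'I_n}) (C : {set T}) f :
  partial_inj A C f -> p \in A -> q \in A -> pullback s f != f.
Proof.
move=> /partial_injP[_ _ f_inj] pA qA; apply: contra (adjacent_neq pq).
by move/eqP/ffunP/(_ p); rewrite ffunE tpermL => /f_inj ->.
Qed.

Lemma level_factor_both (A B : {set 'I_n}) (t y : 'I_n -> F) :
  A \subset B -> p \in A -> q \in A ->
  level_factor h A B t y
  = common_factor h p q A B t y * pair_factor h (t p) (t q) (y p) (y q).
Proof.
by move=> /subsetP sAB pA qA; rewrite (level_factorE h pq) pA qA !sAB.
Qed.

Lemma nested_sum_exchange_both X k y :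
  p \in sublevel X k.+1 -> q \in sublevel X k.+1 ->
  (forall f, partial_inj (sublevel X k.+1) (D k.+1) f ->
    exchange_relation h (wsum k) X (pvalue z f) /\
    exchange_relation h (wsum k) (pullback s X) (pvalue z f)) ->
  exchange_relation h (wsum k.+1) X y.
Proof.
move=> pA qA exch; have sAB := sublevelS X k.+1.
have pqA : (p \in sublevel X k.+1) = (q \in sublevel X k.+1) by rewrite pA qA.
have pqB : (p \in sublevel X k.+2) = (q \in sublevel X k.+2).
  by rewrite !(subsetP sAB).
rewrite /exchange_relation !nested_sumS !sublevel_pullback.
rewrite (preim_tperm_id pqA) (preim_tperm_id pqB) !mulr_sumr -big_split.
apply: (eq_sumr_involution (@pullback_tpermK _ _ p q)) => [f|f fA|f fA] /=.
- by rewrite -{1}(preim_tperm_id pqA) partial_inj_pullback.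
- exact: pullback_tperm_neq fA pA qA.
have pvalue_s := pvalue_pullback z s f.
rewrite !(eq_level_factor _ _ _ _ pvalue_s) !(eq_nested_sum _ _ _ _ _ pvalue_s).
rewrite !level_factor_both // !common_factor_tperml_id //.
rewrite common_factor_tpermr_id //= !tpermL !tpermR.
have [t1_neq0 t2_neq0 neq_t12 neq_ht12] := pvalue_admissible fA pA qA.
have [exch1 exch2] := exch f fA.
rewrite /exchange_relation pullback_tpermK !ffunE tpermL tpermR in exch1 exch2.
have := pair_factor_exchange (y p) (y q) t1_neq0 t2_neq0 neq_t12 neq_ht12
  exch1 exch2.
move/(congr1 ( *%R (common X k.+1 f y))) => pair_exch.
by apply: etrans (etrans _ pair_exch) _; ring.
Qed.

Lemma nested_sum_left X k y :
  p \in sublevel X k.+1 -> q \notin sublevel X k.+1 -> q \in sublevel X k.+2 ->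
  nested_sum h (sublevel X) D z k.+1 y
  = \sum_(f | partial_inj (sublevel X k.+1) (D k.+1) f)
      common X k.+1 f y * (1 - y q / pvalue z f p)
        * nested_sum h (sublevel X) D z k (pvalue z f).
Proof.
move=> pA /negPf qA qB; apply: eq_bigr => f _.
by rewrite (level_factorE h pq) pA qA qB /= !mulr1.
Qed.

Lemma nested_sum_right X k y :
  p \in sublevel X k.+1 -> q \notin sublevel X k.+1 -> q \in sublevel X k.+2 ->
  nested_sum h (sublevel (pullback s X)) D z k.+1 y
  = \sum_(f | partial_inj (sublevel X k.+1) (D k.+1) f)
      common X k.+1 f y * (1 - h * y p / pvalue z f p)
        * nested_sum h (sublevel X) D z k (pvalue z f).
Proof.
move=> pA qA qB; have pB := subsetP (sublevelS X k.+1) p pA.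
rewrite nested_sumS (reindex_inj (@pullback_inj _ _ s)) !sublevel_pullback.
under eq_bigl => f do rewrite partial_inj_pullback.
have pqB : (p \in sublevel X k.+2) = (q \in sublevel X k.+2) by rewrite pB qB.
rewrite (preim_tperm_id pqB); apply: eq_bigr => f _.
have pvalue_s := pvalue_pullback z s f.
rewrite (eq_level_factor _ _ _ _ pvalue_s) (eq_nested_sum _ _ _ _ _ pvalue_s).
have pqA : ~~ ((p \in sublevel X k.+1) && (q \in sublevel X k.+1)).
  by rewrite (negPf qA) andbF.
rewrite (nested_sum_pullback _ _ _ _ pq (sublevel_pullback X s)) //; last first.
  exact: sublevelS.
rewrite (level_factorE h pq) (common_factor_tperml h pq).
rewrite ![_ \in _ @^-1: _]in_set !tpermL !tpermR pA pB (negPf qA) /= tpermR.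
by rewrite !mul1r.
Qed.

Lemma nested_sum_exchange_one X k y :
  p \in sublevel X k.+1 -> q \notin sublevel X k.+1 -> q \in sublevel X k.+2 ->
  exchange_relation h (wsum k.+1) X y /\
  exchange_relation h (wsum k.+1) (pullback s X) y.
Proof.
move=> pA qA qB; have pB := subsetP (sublevelS X k.+1) p pA.
have ltXpq : (X p < X q)%N.
  by move: pA qA; rewrite !inE -leqNgt => /leq_trans; apply.
rewrite /exchange_relation pullback_tpermK !ffunE tpermL tpermR.
rewrite /exchange_diag /exchange_off ltXpq ltnNge ltnW //.
have commonR f : common X k.+1 f (y \o s) = common X k.+1 f y.
  by rewrite common_factor_tpermr_id // pB.
rewrite !(nested_sum_left _ pA qA qB) !(nested_sum_right _ pA qA qB).
rewrite !mulr_sumr -!big_split /=.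
by split; apply: eq_bigr => f _; rewrite commonR ?tpermL ?tpermR; ring.
Qed.

Lemma nested_sum_exchange_none X k y :
  X p = X q -> p \notin sublevel X k.+1 -> exchange_relation h (wsum k.+1) X y.
Proof.
move=> eqX pA; have qA : q \notin sublevel X k.+1 by move: pA; rewrite !inE eqX.
rewrite /exchange_relation /exchange_diag /exchange_off eqX ltnn mul0r addr0.
congr (_ * _); apply: eq_bigr => f _; congr (_ * _).
rewrite !(level_factorE h pq) !(negPf pA) !(negPf qA) /=.
by rewrite common_factor_tpermr_id // !inE eqX.
Qed.

Lemma nested_sum_exchange X k y : (X p <= k)%N -> (X q <= k)%N ->
  exchange_relation h (wsum k) X y.
Proof.
elim: k X y => [|k IH] X y Xp Xq.
  rewrite /exchange_relation /exchange_diag /exchange_off.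
  by move: Xp Xq; rewrite !leqn0 => /eqP-> /eqP->; rewrite ltnn mul0r addr0.
have [pA|pA] := boolP (p \in sublevel X k.+1);
  have [qA|qA] := boolP (q \in sublevel X k.+1).
- apply: nested_sum_exchange_both => // f _; rewrite !inE !ltnS in pA qA.
  by split; apply: IH; rewrite ?ffunE ?tpermL ?tpermR.
- by have [] := nested_sum_exchange_one y pA qA; rewrite ?inE.
- rewrite -[X](pullback_tpermK p q).
  by apply: (nested_sum_exchange_one _ _ _ _).2;
     rewrite sublevel_pullback in_set ?tpermL ?tpermR // inE.
apply: nested_sum_exchange_none => //; apply: val_inj.
rewrite !inE -!leqNgt in pA qA.
by apply/eqP; rewrite eqn_leq (leq_trans Xp) ?(leq_trans Xq).
Qed.

End Exchange.

(** * Triangularity and diagonal values *)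

Section Triangularity.
Variables (F : fieldType) (n : nat) (h : F) (z : 'I_n -> F).
Hypothesis z_neq0 : forall i, z i != 0.
Implicit Types (y : 'I_n -> F) (f : {ffun 'I_n -> option 'I_n}).

Lemma level_factor_neq0_deflationary (A B D : {set 'I_n}) f y :
  partial_inj A D f -> D \subset B -> {in B, y =1 z} ->
  level_factor h A B (pvalue z f) y != 0 -> deflationary A f.
Proof.
move=> /partial_injP[_ fD _] /subsetP sDB yz lf_neq0 i d iA fi.
rewrite leqNgt; apply: contra lf_neq0 => lt_id.
have dB : d \in B by have [e eD] := fD i iA; rewrite fi => -[->]; apply: sDB.
have fiE : pvalue z f i = z d by rewrite /pvalue fi.
by rewrite (level_factor_eq0 h iA dB lt_id) ?fiE // yz.
Qed.

Section StaircaseSets.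
Variables A D : nat -> {set 'I_n}.
Hypotheses (D_mono : forall j, D j \subset D j.+1)
  (card_AD : forall j, #|A j| = #|D j|)
  (closed_AD : (forall j, down_closed (A j)) \/ (forall j, up_closed (D j))).

Lemma nested_sumS_triangular k y : A k.+2 = D k.+2 -> {in A k.+2, y =1 z} ->
  nested_sum h A D z k.+1 y = (A k.+1 == D k.+1)%:R *
    (level_factor h (A k.+1) (A k.+2) z z * nested_sum h A D z k z).
Proof.
move=> eqAD yz; rewrite nested_sumS.
have term_eq0 f : partial_inj (A k.+1) (D k.+1) f ->
    ~ deflationary (A k.+1) f ->
    level_factor h (A k.+1) (A k.+2) (pvalue z f) y
      * nested_sum h A D z k (pvalue z f) = 0.
  move=> f_pinj f_ndefl; apply/eqP; rewrite mulf_eq0; apply/orP; left.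
  apply: contraT => /level_factor_neq0_deflationary f_defl.
  by case: f_ndefl; apply: f_defl f_pinj _ yz; rewrite eqAD.
have [eqAD1|neqAD1] := eqVneq (A k.+1) (D k.+1); last first.
  rewrite mul0r big1 // => f f_pinj; apply: term_eq0 => // f_defl.
  case/eqP: neqAD1; apply: deflationary_eq_domain f_pinj f_defl _ => //.
  by case: closed_AD; [left|right].
rewrite -eqAD1 in term_eq0 *.
rewrite (bigD1 (partial_id (A k.+1))) ?partial_idP //=.
rewrite big1 ?addr0 => [|f /andP[f_pinj /eqP f_neq]]; last first.
  by apply: term_eq0 => // f_defl; apply/f_neq/deflationary_eq_id.
have pvalue_id : {in A k.+1, pvalue z (partial_id (A k.+1)) =1 z}.
  by move=> i iA; rewrite /pvalue ffunE iA.
rewrite mul1r (eq_in_level_factor _ pvalue_id yz).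
by rewrite (eq_in_nested_sum _ _ _ pvalue_id).
Qed.

Lemma nested_sum_triangular k : A k.+1 = D k.+1 ->
  nested_sum h A D z k z
  = \prod_(1 <= j < k.+1) ((A j == D j)%:R * level_factor h (A j) (A j.+1) z z).
Proof.
elim: k => [|k IH] eqAD; first by rewrite big_geq.
rewrite nested_sumS_triangular // big_nat_recr //=.
have [eqAD1|_] := eqVneq (A k.+1) (D k.+1); last by rewrite !mul0r mulr0.
by rewrite IH // !mul1r mulrC.
Qed.

End StaircaseSets.

Hypothesis z_inj : injective z.

Lemma cross_inner_factor_diag i (A : {set 'I_n}) : i \in A ->
  (1 - h) * ((\prod_(c in A) cross_factor h i c (z i) (z c))
             * \prod_(c in A | (i < c)%N) inner_factor h (z i) (z c))
  = \prod_(c in A) (1 - h * z c / z i).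
Proof.
move=> iA; rewrite [X in _ * (_ * X)]big_mkcondr -big_split.
rewrite (bigD1 i) // [RHS](bigD1 i) //= /cross_factor !ltnn !mul1r mulfK //.
congr (_ * _); apply: eq_bigr => c /andP[_ neq_ci].
case: (ltngtP c i) => [_|_|/val_inj eq_ci]; first by rewrite mulr1.
  by rewrite /inner_factor mulrC divfK // subr1_div_eq0 // (inj_eq z_inj).
by rewrite eq_ci eqxx in neq_ci.
Qed.

Lemma level_factor_diag (A B : {set 'I_n}) : A \subset B ->
  (\prod_(i in A) (1 - h)) * level_factor h A B z z
  = (\prod_(i in A) \prod_(c in A) (1 - h * z c / z i))
    * \prod_(i in A) \prod_(c in B :\: A) cross_factor h i c (z i) (z c).
Proof.
move=> /setIidPr sAB; rewrite level_factor_rows -!big_split.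
apply: eq_bigr => i iA.
by rewrite /= (big_setID A) sAB -(cross_inner_factor_diag iA) /=; ring.
Qed.

End Triangularity.

(** * From ranks to positions *)

Section Positions.
Variables (N n : nat) (lam : 'I_N -> nat) (X : coloring N n).
Hypothesis partX : is_part lam X.

(* i^{(k)}_{a+1} *)
Definition position k (a : 'I_(lamc lam k)) : 'I_n :=
  enum_val (cast_ord (esym (card_sublevel k partX)) a).

Lemma position_inj k : injective (position (k := k)).
Proof. by move=> a b /enum_val_inj/cast_ord_inj. Qed.

Lemma position_in k (a : 'I_(lamc lam k)) : position a \in sublevel X k.
Proof. exact: enum_valP. Qed.

Lemma position_im k : position (k := k) @: 'I_(lamc lam k) = sublevel X k.
Proof.
apply/eqP; rewrite eqEcard card_imset; last exact: position_inj.
rewrite card_ord (card_sublevel k partX) leqnn andbT.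
by apply/subsetP=> _ /imsetP[a _ ->]; apply: position_in.
Qed.

Lemma ilistE k : ilist X k = map val (enum (sublevel X k)).
Proof.
congr map; rewrite {2}/enum_mem -enumT; apply: eq_filter => i.
by rewrite /= inE.
Qed.

Lemma nth_ilist k (a : 'I_(lamc lam k)) : nth 0%N (ilist X k) a = position a.
Proof.
rewrite ilistE (nth_map (position a)) -?cardE ?(card_sublevel k partX) //.
by rewrite [in RHS]/position (enum_val_nth (position a)).
Qed.

Lemma ltn_position k (a b : 'I_(lamc lam k)) :
  (position a < position b)%N = (a < b)%N.
Proof.
have size_ilist : size (ilist X k) = lamc lam k.
  by rewrite ilistE size_map -cardE (card_sublevel k partX).
have sorted_ilist : sorted ltn (ilist X k).
  apply: (subseq_sorted ltn_trans) (iota_ltn_sorted 0 n).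
  by rewrite -val_enum_ord map_subseq // filter_subseq.
have mono := sorted_ltn_nth ltn_trans 0%N sorted_ilist.
rewrite -!nth_ilist; have [lt_ab|lt_ba|->] := ltngtP a b; last by rewrite ltnn.
  by rewrite mono // inE size_ilist.
by apply/negbTE; rewrite -leqNgt ltnW // mono // inE size_ilist.
Qed.

Lemma big_position_cond (R : Type) (idx : R) (op : Monoid.com_law idx) k
    (P : pred 'I_n) (G : 'I_n -> R) :
  \big[op/idx]_(i in sublevel X k | P i) G i
  = \big[op/idx]_(a < lamc lam k | P (position a)) G (position a).
Proof.
rewrite -position_im big_imset_cond // => a b _ _; exact: position_inj.
Qed.

Lemma big_position (R : Type) (idx : R) (op : Monoid.com_law idx) k
    (G : 'I_n -> R) :
  \big[op/idx]_(i in sublevel X k) G i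
  = \big[op/idx]_(a < lamc lam k) G (position a).
Proof.
by rewrite -position_im big_imset // => a b _ _; exact: position_inj.
Qed.

End Positions.

Section WeightFunctionAsNestedSum.
Variables (F : fieldType) (N n : nat) (lam : 'I_N -> nat) (h : F).
Implicit Types (X M : coloring N n) (t : nat -> nat -> F) (z y : 'I_n -> F).

Lemma zf_val z (i : 'I_n) : zf z i = z i.
Proof. by rewrite /zf valK. Qed.

Lemma tsub_position X (partX : is_part lam X) z k (a : 'I_(lamc lam k)) :
  tsub X z k a = z (position partX a).
Proof. by rewrite /tsub (nth_ilist partX) zf_val. Qed.

Definition rank_level_factor X k (tk yk : nat -> F) : F :=
  \prod_(0 <= a < lamc lam k)
    ((\prod_(0 <= c < lamc lam k.+1)
        cross_factor h (nth 0%N (ilist X k) a) (nth 0%N (ilist X k.+1) c)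
          (tk a) (yk c))
     * \prod_(a.+1 <= b < lamc lam k) inner_factor h (tk a) (tk b)).

Lemma UE X t z :
  U lam X t z h
  = \prod_(1 <= k < N) rank_level_factor X k (tt N t z k) (tt N t z k.+1).
Proof. by []. Qed.

Lemma eq_rank_level_factor X k tk tk' yk yk' : tk =1 tk' -> yk =1 yk' ->
  rank_level_factor X k tk yk = rank_level_factor X k tk' yk'.
Proof.
move=> eq_t eq_y; apply: eq_bigr => a _; congr (_ * _).
  by apply: eq_bigr => c _; rewrite eq_t eq_y.
by apply: eq_bigr => b _; rewrite !eq_t.
Qed.

Lemma rank_level_factor_position X (partX : is_part lam X) k
    (tk yk : nat -> F) (t y : 'I_n -> F) :
  (forall a : 'I_(lamc lam k), tk a = t (position partX a)) ->
  (forall c : 'I_(lamc lam k.+1), yk c = y (position partX c)) ->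
  rank_level_factor X k tk yk
  = level_factor h (sublevel X k) (sublevel X k.+1) t y.
Proof.
move=> tkE ykE; rewrite level_factor_rows (big_position partX).
rewrite /rank_level_factor big_mkord; apply: eq_bigr => a _.
rewrite (big_position partX) (big_position_cond partX) big_mkord big_geq_mkord.
congr (_ * _).
  by apply: eq_bigr => c _; rewrite tkE ykE !(nth_ilist partX).
apply: eq_big => [b|b _]; last by rewrite !tkE.
by rewrite ltn_position.
Qed.

Lemma symk_factor m (f c : (nat -> nat -> F) -> F) t :
  (forall k (s : 'S_(lamc lam k)) t', (k <= m)%N -> c (permlev s t') = c t') ->
  symk lam m (fun t' => f t' * c t') t = symk lam m f t * c t.
Proof.
elim: m t => //= m IH t cE; rewrite mulr_suml; apply: eq_bigr => s _.
by rewrite IH ?cE // => k s' t' km; rewrite cE // leqW.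
Qed.

Lemma tt_permlev z k (s : 'S_(lamc lam k)) t j : (k < j)%N ->
  tt N (permlev s t) z j =1 tt N t z j.
Proof. by move=> kj a; rewrite /tt /permlev (gtn_eqF kj). Qed.

Lemma tt_permlev_diag z k (s : 'S_(lamc lam k)) t (a : 'I_(lamc lam k)) :
  (k < N)%N -> tt N (permlev s t) z k a = t k (s a).
Proof. by move=> kN; rewrite /tt ltn_eqF // /permlev eqxx valK. Qed.

Lemma eq_symk m (f g : (nat -> nat -> F) -> F) t : f =1 g ->
  symk lam m f t = symk lam m g t.
Proof. by move=> fg; elim: m t => //= m IH t; apply: eq_bigr => s _. Qed.

Lemma symk_nested_sum X M (partX : is_part lam X) (partM : is_part lam M)
    z z' m t y :
  (m < N)%N ->
  (forall k (a : 'I_(lamc lam k)), (k <= m)%N ->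
    t k a = z (position partM a)) ->
  (forall c : 'I_(lamc lam m.+1), tt N t z' m.+1 c = y (position partX c)) ->
  symk lam m (fun t' => \prod_(1 <= k < m.+1)
    rank_level_factor X k (tt N t' z' k) (tt N t' z' k.+1)) t
  = nested_sum h (sublevel X) (sublevel M) z m y.
Proof.
elim: m t y => [|m IH] t y mN tE yE; first by rewrite /= big_geq.
rewrite nested_sumS -(position_im partX) -(position_im partM).
rewrite big_partial_inj; [|exact: position_inj|exact: position_inj].
rewrite !position_im /=; apply: eq_bigr => s _.
under eq_symk do rewrite big_nat_recr //=.
rewrite symk_factor => [|k s' t' km]; last first.
  by apply: eq_rank_level_factor; apply: tt_permlev; rewrite ?ltnS // leqW.
have valueE (a : 'I_(lamc lam m.+1)) : tt N (permlev s t) z' m.+1 a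
    = pvalue z (pinj_of_perm (position partX (k := m.+1))
                             (position partM (k := m.+1)) s) (position partX a).
  rewrite tt_permlev_diag // tE // /pvalue pinj_of_permE //.
  exact: position_inj.
rewrite mulrC; congr (_ * _).
  apply: (rank_level_factor_position (partX := partX)) => // c.
  by rewrite tt_permlev // yE.
apply: IH => // [|k a km]; first exact: ltnW.
by rewrite /permlev ltn_eqF // tE // leqW.
Qed.

Hypothesis sum_lam : (\sum_(j < N) lam j)%N = n.

Lemma lamcN : lamc lam N = n.
Proof. by rewrite -sum_lam; apply: eq_bigl => j; rewrite ltn_ord. Qed.

Lemma position_last X (partX : is_part lam X) (a : 'I_(lamc lam N)) :
  position partX a = a :> nat.
Proof.
rewrite -(nth_ilist partX) /ilist (eq_filter (a2 := predT)) => [|i].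
  by rewrite filter_predT val_enum_ord nth_iota // -lamcN.
by rewrite /= ltn_ord.
Qed.

Lemma W_nested_sum X M z y : is_part lam X -> is_part lam M ->
  W lam X (tsub M z) y h
  = (1 - h) ^+ lam1 lam * nested_sum h (sublevel X) (sublevel M) z N.-1 y.
Proof.
move=> partX partM; congr (_ * _).
have [N0|N_gt0] := posnP N.
  by rewrite (_ : N.-1 = 0%N) ?N0 //= /U big_geq // N0.
rewrite -(@symk_nested_sum X M partX partM z y N.-1 (tsub M z) y).
- by apply: eq_symk => t; rewrite UE prednK.
- by rewrite prednK.
- by move=> k a _; rewrite (tsub_position partM).
- by rewrite prednK // => c; rewrite /tt eqxx -(position_last partX) zf_val.
Qed.

Definition E_at M z : F :=
  \prod_(1 <= k < N) \prod_(i in sublevel M k) \prod_(c in sublevel M k)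
    (1 - h * z c / z i).

Lemma E_tsub M z : is_part lam M -> E lam (tsub M z) h = E_at M z.
Proof.
move=> partM; apply: eq_bigr => k _.
rewrite (big_position partM) big_mkord; apply: eq_bigr => a _.
rewrite (big_position partM) big_mkord; apply: eq_bigr => b _.
by rewrite !(tsub_position partM).
Qed.

Lemma exp_lam1 X (x : F) : is_part lam X ->
  x ^+ lam1 lam = \prod_(1 <= k < N) \prod_(i in sublevel X k) x.
Proof.
move=> partX; rewrite /lam1 expr_sum; apply: eq_bigr => k _.
by rewrite -(card_sublevel k partX) prodr_const.
Qed.

End WeightFunctionAsNestedSum.

(** * Inversions *)

Section Inversions.
Local Open Scope nat_scope.

Lemma inversions_cons x s :
  inversions (x :: s) = \sum_(y <- s) (y < x) + inversions s.
Proof.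
rewrite /inversions /= big_nat_recl //=; congr (_ + _).
  by rewrite big_add1 /= [RHS](big_nth 0).
by apply: eq_bigr => a _; rewrite big_add1.
Qed.

Lemma inversions_pairwise (T : eqType) (v : T -> nat) (r : rel T) s :
  (forall a b, r a b -> ~~ r b a) -> pairwise r s ->
  inversions (map v s) = \sum_(a <- s) \sum_(b <- s) (r a b && (v b < v a)).
Proof.
move=> r_asym; elim: s => [|x s IH] /=.
  by rewrite big_nil /inversions big_geq.
case/andP=> /allP r_x r_s; rewrite inversions_cons big_map IH // !big_cons.
rewrite ltnn andbF add0n; congr (_ + _).
  by apply: eq_big_seq => b /r_x ->.
by apply: eq_big_seq => a /r_x/r_asym/negPf; rewrite big_cons => ->.
Qed.

Lemma pairwise_enum_ord m : pairwise (fun i j : 'I_m => i < j) (enum 'I_m).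
Proof.
rewrite -(pairwise_map val ltn) val_enum_ord -sorted_pairwise //.
  exact: iota_ltn_sorted.
exact: ltn_trans.
Qed.

Variables N n : nat.
Implicit Type K : coloring N n.

Definition reading_order K : rel 'I_n :=
  fun a b => (K b < K a) || ((K a == K b) && (a < b)).

Definition reading_word K : seq 'I_n :=
  flatten [seq [seq i <- enum 'I_n | K i == j] | j <- rev (enum 'I_N)].

Lemma seqK_reading_word K : seqK K = map val (reading_word K).
Proof. by rewrite /reading_word map_flatten -map_comp. Qed.

Lemma reading_order_asym K a b : reading_order K a b -> ~~ reading_order K b a.
Proof. by rewrite /reading_order -!val_eqE /=; lia. Qed.

Lemma pairwise_reading_word K : pairwise (reading_order K) (reading_word K).
Proof.
rewrite /reading_word.
have: pairwise (fun a b : 'I_N => b < a) (rev (enum 'I_N)).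
  rewrite -sorted_pairwise ?rev_sorted => [|a b c ba cb].
    by rewrite sorted_pairwise ?pairwise_enum_ord // => a b c; apply: ltn_trans.
  exact: ltn_trans cb ba.
elim: (rev _) => //= j js IH /andP[/allP lt_j /IH{}IH].
rewrite pairwise_cat IH andbT; apply/andP; split.
  apply/allrelP => a b; rewrite mem_filter => /andP[/eqP Ka _].
  case/flatten_mapP=> k /lt_j lt_kj; rewrite mem_filter => /andP[/eqP Kb _].
  by rewrite /reading_order Ka Kb lt_kj.
apply: (sub_in_pairwise (P := fun i => K i == j) (r := fun a b => a < b) _
         (filter_all _ _)).
  by move=> a b /eqP Ka /eqP Kb; rewrite /reading_order Ka Kb eqxx ltnn.
exact/pairwise_filter/pairwise_enum_ord.
Qed.

Lemma perm_reading_word K : perm_eq (reading_word K) (enum 'I_n).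
Proof.
apply: uniq_perm => [||i]; rewrite ?enum_uniq //.
  apply: pairwise_uniq (pairwise_reading_word K) => i.
  by rewrite /reading_order !ltnn andbF.
rewrite mem_enum; apply/flatten_mapP; exists (K i).
  by rewrite mem_rev mem_enum.
by rewrite mem_filter eqxx mem_enum.
Qed.

Definition coinversions K : {set 'I_n * 'I_n} :=
  [set x : 'I_n * 'I_n | (x.1 < x.2) && (K x.1 < K x.2)].

Lemma pinvE K : pinv K = #|coinversions K|.
Proof.
rewrite /pinv seqK_reading_word.
rewrite (inversions_pairwise _ (@reading_order_asym K)); last first.
  exact: pairwise_reading_word.
under eq_bigr => a _ do rewrite (perm_big _ (perm_reading_word K)) big_enum.
rewrite (perm_big _ (perm_reading_word K)) big_enum exchange_big pair_big /=.
rewrite -sum1_card [RHS]big_mkcond; apply: eq_bigr => -[a b] _ /=.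
rewrite inE /reading_order /=.
by case: (ltngtP a b) => //= _; rewrite ?andbF ?andbT; case: (_ < _).
Qed.

Lemma card_coinversions_tperm K (p q : 'I_n) : q = p.+1 :> nat -> K p < K q ->
  #|coinversions K| = #|coinversions (pullback (tperm p q) K)|.+1.
Proof.
move=> pq ltKpq; have ltpq : p < q by rewrite pq.
have [ltqp ltKqp] := (leq_gtF (ltnW ltpq), leq_gtF (ltnW ltKpq)).
have [neq_pq neq_qp] : (p == q) = false /\ (q == p) = false.
  by rewrite -!val_eqE /= ltn_eqF ?gtn_eqF.
pose ss (x : 'I_n * 'I_n) := (tperm p q x.1, tperm p q x.2).
have ssK : involutive ss by case=> i c; rewrite /ss !tpermK.
rewrite -[in RHS](card_preimset _ (inv_inj ssK)) -add1n.
have -> : coinversions K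
    = (p, q) |: ss @^-1: coinversions (pullback (tperm p q) K).
  apply/setP=> -[i c]; rewrite !inE !ffunE !tpermK xpair_eqE.
  have [|nsw] := boolP (swapped_pair p q (i, c)); last first.
    rewrite ltn_tperm //; case: (i =P p) => [ip|] //=; case: (c =P q) => // cq.
    by move: nsw; rewrite /swapped_pair ip cq !inE !eqxx orbT.
  rewrite /swapped_pair /= => /andP[] /orP[]/eqP-> /orP[]/eqP-> /=;
    by rewrite ?tpermL ?tpermR ?eqxx ?ltnn ?ltpq ?ltqp ?ltKpq ?ltKqp
               ?neq_pq ?neq_qp ?andbF.
by rewrite cardsU1 !inE !ffunE /= tpermL tpermR ltqp.
Qed.

End Inversions.

Section SortingInduction.
Variables N n : nat.
Implicit Types K : coloring N n.

Definition weakly_increasing K : Prop :=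
  forall i c : 'I_n, (i <= c)%N -> (K i <= K c)%N.

Lemma adjacent_weakly_increasing K :
  (forall p q : 'I_n, q = p.+1 :> nat -> (K p <= K q)%N) -> weakly_increasing K.
Proof.
move=> K_adj i c; have [m] := ubnP (c : nat); elim: m c => // m IH c.
rewrite ltnS => cm; rewrite leq_eqVlt => /predU1P[/val_inj -> //|lt_ic].
have lt_cn : (c.-1 < n)%N := leq_ltn_trans (leq_pred c) (ltn_ord c).
have c_gt0 : (0 < c)%N := leq_ltn_trans (leq0n i) lt_ic.
apply: leq_trans (K_adj (Ordinal lt_cn) c _); last by rewrite /= prednK.
by apply: IH; rewrite /= ?prednK // -ltnS prednK.
Qed.

Lemma coloring_tperm_ind (P : coloring N n -> Prop) :
  (forall K, weakly_increasing K -> P K) ->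
  (forall K (p q : 'I_n), q = p.+1 :> nat -> (K p < K q)%N -> P K ->
     P (pullback (tperm p q) K)) ->
  forall K, P K.
Proof.
move=> P_incr P_tperm K.
have [m] := ubnP (#|{: 'I_n * 'I_n}| - #|coinversions K|)%N.
elim: m K => // m IH K; rewrite ltnS => measure_K.
have [/existsP[p /existsP[q /andP[/eqP pq Kqp]]]|no_descent] := boolP
  [exists p : 'I_n, exists q : 'I_n, (q == p.+1 :> nat) && (K q < K p)%N];
  last first.
  apply/P_incr/adjacent_weakly_increasing => p q pq.
  move: no_descent; rewrite leqNgt; apply: contra => Kqp.
  by apply/existsP; exists p; apply/existsP; exists q; rewrite pq eqxx.
rewrite -[K](pullback_tpermK p q); set K' := pullback (tperm p q) K.
have K'pq : (K' p < K' q)%N by rewrite !ffunE tpermL tpermR.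
apply: P_tperm => //; apply: IH.
have := card_coinversions_tperm pq K'pq; rewrite pullback_tpermK => card_K'.
apply: leq_trans measure_K; rewrite card_K' ltn_sub2l // -card_K'.
exact: max_card.
Qed.

End SortingInduction.

(** * The pairing *)

Section TwoPointWeight.
Variables (F : fieldType) (N n : nat) (lam : 'I_N -> nat).
Implicit Types (g : F) (X M : coloring N n) (y z : 'I_n -> F).
Implicit Type u : {perm 'I_n}.

Lemma admissible_perm g z u : admissible g z -> admissible g (z \o u).
Proof.
case=> z_neq0 z_inj gz; split=> //=; exact: inj_comp z_inj perm_inj.
Qed.

Lemma admissible_inv g z :
  admissible g z -> admissible g^-1 (fun i => (z i)^-1).
Proof.
case=> z_neq0 z_inj gz; split=> [i|i j /invr_inj/z_inj //|i j].
  by rewrite invr_eq0.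
by rewrite -invfM (inj_eq invr_inj).
Qed.

(* The value at t = z_M of the weight function of X, with z replaced by y:
   the exchange relation moves y while t stays fixed. *)
Definition Wtilde g X M z y : F :=
  (1 - g) ^+ lam1 lam / E_at g M z
  * nested_sum g (sublevel X) (sublevel M) z N.-1 y.

Lemma Wt_Wtilde g (sigma : 'S_n) X M z :
  (\sum_(j < N) lam j)%N = n -> is_part lam X -> is_part lam M ->
  Wt lam sigma X M z g = Wtilde g (pullback sigma X) M z (z \o sigma).
Proof.
move=> sum_lam partX partM.
rewrite /Wt /Wsig (W_nested_sum _ sum_lam) ?is_part_pullback // E_tsub //.
exact: mulrAC.
Qed.

Lemma eq_Wtilde g X M z y y' : y =1 y' -> Wtilde g X M z y = Wtilde g X M z y'.
Proof. by move=> eq_y; congr (_ * _); apply: eq_nested_sum. Qed.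

Lemma E_at_perm g u M z : E_at g (pullback u M) (z \o u) = E_at g M z.
Proof.
apply: eq_bigr => k _; rewrite sublevel_pullback.
rewrite [RHS](reindex_inj (@perm_inj _ u)).
apply: eq_big => [i|i _]; first by rewrite inE.
by rewrite [RHS](reindex_inj (@perm_inj _ u)); apply: eq_bigl => c; rewrite inE.
Qed.

Lemma Wtilde_perm g u X M z y :
  Wtilde g X (pullback u M) (z \o u) y = Wtilde g X M z y.
Proof.
rewrite /Wtilde E_at_perm; congr (_ * _).
exact/nested_sum_perm/sublevel_pullback.
Qed.

Lemma Wtilde_exchange g (p q : 'I_n) X M z y :
  q = p.+1 :> nat -> admissible g z ->
  exchange_relation p q g (fun X => Wtilde g X M z) X y.
Proof.
move=> pq z_adm.
have le_pred i : (X i <= N.-1)%N.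
  by rewrite -ltnS (leq_trans (ltn_ord _)) ?leqSpred.
have := nested_sum_exchange pq (sublevel M) z_adm y (le_pred p) (le_pred q).
rewrite /exchange_relation /Wtilde mulrCA => ->.
by ring.
Qed.

End TwoPointWeight.

Section ReverseOrder.
Variable n : nat.

Lemma sigma0E (i : 'I_n) : sigma0 n i = rev_ord i.
Proof. by rewrite permE. Qed.

Lemma sigma0K : involutive (sigma0 n).
Proof. by move=> i; rewrite !sigma0E rev_ordK. Qed.

Lemma sigma0V : (sigma0 n)^-1%g = sigma0 n.
Proof.
by apply/permP=> i; apply: (@perm_inj _ (sigma0 n)); rewrite permKV sigma0K.
Qed.

End ReverseOrder.

Section Pairing.
Variables (F : fieldType) (N n : nat) (lam : 'I_N -> nat) (h : F).
Hypothesis h_neq0 : h != 0.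
Implicit Types (J K M : coloring N n) (y z : 'I_n -> F) (u : {perm 'I_n}).
Local Notation r := (sigma0 n).

(* The dual function of K at t = z_M, with z replaced by y; it includes the
   factor h^p(K). *)
Definition dual_Wtilde K M z y : F :=
  h ^+ #|coinversions K|
  * Wtilde lam h^-1 (pullback r K) M (fun i => (z i)^-1)
      (fun i => (y (r i))^-1).

Lemma dual_Wtilde_perm u K M z y :
  dual_Wtilde K (pullback u M) (z \o u) y = dual_Wtilde K M z y.
Proof.
by congr (_ * _); apply: (Wtilde_perm lam _ u _ M (fun i => (z i)^-1)).
Qed.

Section Adjacent.
Variables p q : 'I_n.
Hypothesis pq : q = p.+1 :> nat.
Local Notation s := (tperm p q).

(* Conjugation by sigma_0, and inversion of y and h, transpose the matrix of
   coefficients of the exchange relation. *)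
Lemma dual_Wtilde_exchange K M z y : admissible h z -> (forall i, y i != 0) ->
  adjoint_exchange_relation p q h (fun X => dual_Wtilde X M z) K y.
Proof.
move=> /admissible_inv z_adm y_neq0.
have rqp : r p = (r q).+1 :> nat.
  by rewrite !sigma0E /= pq; have := ltn_ord q; lia.
have conj_s : (tperm (r q) (r p) * r = r * s)%g.
  by rewrite tpermC -tpermJ conjgE -{3}[r]sigma0V mulgA mulgK sigma0V.
have := Wtilde_exchange lam (pullback r K) M (fun i => (y (s (r i)))^-1) rqp
  z_adm.
rewrite /exchange_relation pullbackM conj_s -pullbackM.
rewrite !ffunE !sigma0K tpermL tpermR.
rewrite (eq_Wtilde _ _ _ _ _ (y' := fun i => (y (r i))^-1)) => [|i]; last first.
  by rewrite /= -[r (_ i)]permM conj_s permM tpermK.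
rewrite /adjoint_exchange_relation /dual_Wtilde /exchange_diag /exchange_off /=.
set w := Wtilde _ _ _ _ _ _.
have -> : (y q - h * y p) * (h ^+ #|coinversions K| * w)
    = - (h * y p * y q * h ^+ #|coinversions K|)
      * (((y q)^-1 - h^-1 * (y p)^-1) * w).
  by field; rewrite h_neq0 !y_neq0.
move=> ->; case: (ltngtP (K p) (K q)) => [ltK|ltK|_].
- rewrite (card_coinversions_tperm pq ltK) exprS.
  by field; rewrite h_neq0 !y_neq0.
- have ltsK : (pullback s K p < pullback s K q)%N.
    by rewrite !ffunE tpermL tpermR.
  rewrite (card_coinversions_tperm pq ltsK) pullback_tpermK exprS.
  by field; rewrite h_neq0 !y_neq0.
by field; rewrite h_neq0 !y_neq0.
Qed.

End Adjacent.

Definition kernel M z : F := Pf M z / (Rf M z * Qf M z h).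

Lemma kernel_perm u M z : kernel (pullback u M) (z \o u) = kernel M z.
Proof.
congr (_ / (_ * _)).
- exact: (big_pullback_ltn _ u M (fun a b => - (z b / z a))).
- exact: (big_pullback_ltn _ u M (fun a b => 1 - z b / z a)).
- exact: (big_pullback_ltn _ u M (fun a b => 1 - h * z b / z a)).
Qed.

Definition pairing J K z y1 y2 : F :=
  \sum_(M | is_part lam M)
    kernel M z * (Wtilde lam h J M z y1 * dual_Wtilde K M z y2).

Lemma pairing_perm u J K z y1 y2 :
  pairing J K (z \o u) y1 y2 = pairing J K z y1 y2.
Proof.
rewrite /pairing (reindex_inj (@pullback_inj _ _ u)).
apply: eq_big => [M|M _]; first exact: is_part_pullback.
by rewrite kernel_perm Wtilde_perm dual_Wtilde_perm.
Qed.

Definition orthonormal J : Prop :=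
  forall K z, is_part lam K -> admissible h z ->
  pairing J K z z z = (J == K)%:R.

Section PairingExchange.
Variables p q : 'I_n.
Hypothesis pq : q = p.+1 :> nat.
Local Notation s := (tperm p q).

Lemma pairing_exchange_left K J z y2 y : admissible h z ->
  exchange_relation p q h (fun X y1 => pairing X K z y1 y2) J y.
Proof.
move=> z_adm; rewrite /exchange_relation /pairing !mulr_sumr -big_split.
apply: eq_bigr => M _ /=.
have := Wtilde_exchange lam J M y pq z_adm; rewrite /exchange_relation => exch.
by rewrite (mulrCA _ (kernel M z)) (mulrA (_ - _)) exch; ring.
Qed.

Lemma pairing_exchange_right J K z y1 y :
  admissible h z -> (forall i, y i != 0) ->
  adjoint_exchange_relation p q h (fun X => pairing J X z y1) K y.
Proof.
move=> z_adm y_neq0.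
rewrite /adjoint_exchange_relation /pairing !mulr_sumr -big_split.
apply: eq_bigr => M _ /=.
have exch := dual_Wtilde_exchange pq K M z_adm y_neq0.
rewrite /adjoint_exchange_relation in exch.
by rewrite (mulrCA _ (kernel M z)) (mulrCA (_ - _)) exch; ring.
Qed.

(* Both sides of the exchange relation for the pairing at (z o s, z) are known:
   the coefficients of the two weight functions are adjoint, so the diagonal
   terms cancel and the off-diagonal one is the pairing of s J and K. *)
Lemma orthonormal_tperm J : (J p < J q)%N -> orthonormal J ->
  orthonormal (pullback s J).
Proof.
move=> ltJ orthJ K z partK z_adm; have [z_neq0 z_inj _] := z_adm.
have zs_adm := admissible_perm s z_adm.
have pairing_zs L : is_part lam L ->
    pairing J L z (z \o s) (z \o s) = (J == L)%:R.
  by move=> partL; rewrite -(pairing_perm s) orthJ.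
have exchJ := pairing_exchange_left K J z z z_adm.
have exchK := pairing_exchange_right J K (z \o s) z_adm z_neq0.
rewrite /exchange_relation /adjoint_exchange_relation in exchJ exchK.
rewrite exchK (orthJ K z) // !pairing_zs ?is_part_pullback // in exchJ.
have off_neq0 : exchange_off h (J p) (J q) (z p) (z q) != 0.
  by rewrite /exchange_off ltJ subr_eq0 (inj_eq z_inj) eq_sym adjacent_neq.
have diagE : exchange_diag h (K p) (K q) (z p) (z q) * (J == K)%:R
    = exchange_diag h (J p) (J q) (z p) (z q) * (J == K)%:R.
  by have [->|_] := eqVneq J K; rewrite ?mulr0.
have offE : exchange_off h (K q) (K p) (z p) (z q) * (J == pullback s K)%:R
    = exchange_off h (J p) (J q) (z p) (z q) * (J == pullback s K)%:R.
  have [->|_] := eqVneq J (pullback s K); rewrite ?mulr0 //.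
  by rewrite !ffunE tpermL tpermR.
rewrite diagE offE in exchJ; move/addrI/(mulfI off_neq0): exchJ => <-.
by rewrite (can2_eq (pullback_tpermK p q) (pullback_tpermK p q)).
Qed.

End PairingExchange.

End Pairing.

Section WeaklyIncreasing.
Variables (F : fieldType) (N n : nat) (lam : 'I_N -> nat).
Implicit Types (X M J K : coloring N n) (z : 'I_n -> F).

Definition weakly_decreasing M : Prop :=
  forall i c : 'I_n, (i <= c)%N -> (M c <= M i)%N.

Lemma Wtilde_triangular g X M z : is_part lam X -> is_part lam M ->
  admissible g z -> weakly_increasing X \/ weakly_decreasing M ->
  Wtilde lam g X M z z = (1 - g) ^+ lam1 lam / E_at g M z
    * \prod_(1 <= j < N) ((sublevel X j == sublevel M j)%:R
        * level_factor g (sublevel X j) (sublevel X j.+1) z z).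
Proof.
move=> partX partM [z_neq0 _ _] mono; rewrite /Wtilde; congr (_ * _).
have [N0|N_gt0] := posnP N.
  by rewrite (_ : N.-1 = 0%N) ?N0 //= big_geq ?N0.
rewrite nested_sum_triangular ?prednK //.
- exact: sublevelS.
- by move=> j; rewrite !(card_sublevel _ (lam := lam)).
- case: mono => mono; [left|right] => j i d; rewrite !inE => lt_j di.
    exact: leq_ltn_trans (mono _ _ di) lt_j.
  exact: leq_ltn_trans (mono _ _ di) lt_j.
- by apply/setP=> i; rewrite !inE !ltn_ord.
Qed.

Lemma sublevel_neq X M : X != M ->
  exists2 j, (0 < j < N)%N & sublevel X j != sublevel M j.
Proof.
move=> neqXM; have [i neq_i] : exists i, X i != M i.
  apply/existsP; apply: contraR neqXM => /existsPn eqXM.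
  by apply/eqP/ffunP=> i; apply/eqP/negbNE/eqXM.
have [ltX ltM] := (ltn_ord (X i), ltn_ord (M i)).
exists (minn (X i) (M i)).+1; first by move: neq_i; rewrite -val_eqE /=; lia.
by apply: contra neq_i => /eqP/setP/(_ i); rewrite !inE -val_eqE /=; lia.
Qed.

Lemma Wtilde_eq0 g X M z : is_part lam X -> is_part lam M ->
  admissible g z -> weakly_increasing X \/ weakly_decreasing M -> X != M ->
  Wtilde lam g X M z z = 0.
Proof.
move=> partX partM z_adm mono /sublevel_neq[j j_bounds /negPf neq_j].
rewrite Wtilde_triangular // (big_rem j) ?mem_index_iota //=.
by rewrite neq_j !mul0r mulr0.
Qed.

Lemma Wtilde_diag g X z : is_part lam X -> admissible g z ->
  weakly_increasing X \/ weakly_decreasing X ->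
  Wtilde lam g X X z z
  = \prod_i \prod_(c | (X i < X c)%N) cross_factor g i c (z i) (z c).
Proof.
move=> partX z_adm mono; have [z_neq0 z_inj gz] := z_adm.
rewrite Wtilde_triangular // (exp_lam1 _ partX) mulrAC -big_split /=.
under eq_bigr => j _ do rewrite eqxx mul1r level_factor_diag ?sublevelS //.
rewrite big_split /= big_sublevelD mulrAC -/(E_at g X z) mulfV ?mul1r //.
rewrite prodf_seq_neq0; apply/allP => k _ /=.
apply/prodf_neq0 => i _; apply/prodf_neq0 => c _.
by rewrite subr1_div_eq0.
Qed.

Lemma Rf_neq0 M z : injective z -> (forall i, z i != 0) -> Rf M z != 0.
Proof.
move=> z_inj z_neq0; apply/prodf_neq0 => i _; apply/prodf_neq0 => c lt_ic.
rewrite subr1_div_eq0 // (inj_eq z_inj); apply: contraTneq lt_ic => ->.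
by rewrite ltnn.
Qed.

Lemma Qf_neq0 h M z : admissible h z -> Qf M z h != 0.
Proof.
case=> z_neq0 _ hz; apply/prodf_neq0 => i _; apply/prodf_neq0 => c _.
by rewrite subr1_div_eq0.
Qed.

Variable h : F.
Hypothesis h_neq0 : h != 0.

Lemma weakly_increasing_ltn J i c :
  weakly_increasing J -> (J i < J c)%N -> (i < c)%N.
Proof. by move=> J_incr; rewrite !ltnNge; apply: contra; apply: J_incr. Qed.

Lemma exp_coinversions J : weakly_increasing J ->
  h ^+ #|coinversions J| = \prod_i \prod_(c | (J i < J c)%N) h.
Proof.
move=> J_incr; rewrite pair_big_dep /= -prodr_const; apply: eq_bigl => x.
by rewrite inE andb_idl //; apply: weakly_increasing_ltn.
Qed.

Lemma Wtilde_increasing J z : is_part lam J -> admissible h z ->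
  weakly_increasing J -> Wtilde lam h J J z z = Rf J z.
Proof.
move=> partJ z_adm J_incr; rewrite Wtilde_diag //; last by left.
apply: eq_bigr => i _; apply: eq_bigr => c.
move/(weakly_increasing_ltn J_incr) => lt_ic.
by rewrite /cross_factor ltnNge ltnW //= lt_ic.
Qed.

Local Notation r := (sigma0 n).

Lemma dual_Wtilde_pullback K M z :
  dual_Wtilde lam h K M z z
  = h ^+ #|coinversions K| * Wtilde lam h^-1 (pullback r K) (pullback r M)
      ((fun i => (z i)^-1) \o r) ((fun i => (z i)^-1) \o r).
Proof. by rewrite Wtilde_perm. Qed.

Lemma weakly_decreasing_sigma0 J :
  weakly_increasing J -> weakly_decreasing (pullback r J).
Proof.
move=> J_incr i c le_ic; rewrite !ffunE !sigma0E.
by apply: J_incr; rewrite /= leq_sub2l.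
Qed.

Lemma dual_Wtilde_eq0 J K z :
  is_part lam J -> is_part lam K -> admissible h z ->
  weakly_increasing J -> K != J -> dual_Wtilde lam h K J z z = 0.
Proof.
move=> partJ partK z_adm J_incr neqKJ.
rewrite dual_Wtilde_pullback Wtilde_eq0 ?mulr0 //.
- by rewrite is_part_pullback.
- by rewrite is_part_pullback.
- exact/admissible_perm/admissible_inv.
- by right; apply: weakly_decreasing_sigma0.
by rewrite (inj_eq (@pullback_inj _ _ r)).
Qed.

Lemma dual_Wtilde_increasing J z : is_part lam J -> admissible h z ->
  weakly_increasing J -> Pf J z * dual_Wtilde lam h J J z z = Qf J z h.
Proof.
move=> partJ z_adm J_incr; have [z_neq0 _ _] := z_adm.
rewrite dual_Wtilde_pullback Wtilde_diag ?is_part_pullback //; last first.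
- by right; apply: weakly_decreasing_sigma0.
- exact/admissible_perm/admissible_inv.
have -> : \prod_i \prod_(c | (pullback r J i < pullback r J c)%N)
      cross_factor h^-1 i c ((z (r i))^-1) ((z (r c))^-1)
    = \prod_i \prod_(c | (J i < J c)%N) (1 - h^-1 * (z c)^-1 / (z i)^-1).
  rewrite -(big_pullback_ltn _ r J (fun i c => 1 - h^-1 * (z c)^-1 / (z i)^-1)).
  apply: eq_bigr => i _; apply: eq_bigr => c; rewrite !ffunE.
  move/(weakly_increasing_ltn J_incr); rewrite !sigma0E /= => lt_ic.
  rewrite /cross_factor ifT ?sigma0E //.
  by have := ltn_ord i; have := ltn_ord c; lia.
rewrite exp_coinversions // -!big_split; apply: eq_bigr => i _.
rewrite -!big_split; apply: eq_bigr => c _ /=.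
by field; rewrite h_neq0 !z_neq0 oner_neq0.
Qed.

Lemma orthonormal_increasing J : is_part lam J -> weakly_increasing J ->
  orthonormal lam h J.
Proof.
move=> partJ J_incr K z partK z_adm; have [z_neq0 z_inj _] := z_adm.
rewrite /pairing (bigD1 J) //= big1 => [|M /andP[partM neqMJ]]; last first.
  by rewrite Wtilde_eq0 ?mul0r ?mulr0 //; [left|rewrite eq_sym].
have [<-|neqJK] := eqVneq J K; last first.
  by rewrite dual_Wtilde_eq0 ?mulr0 ?addr0 // eq_sym.
rewrite addr0 Wtilde_increasing //.
transitivity (Rf J z / Rf J z
    * (Pf J z * dual_Wtilde lam h J J z z / Qf J z h)).
  by rewrite /kernel invfM; ring.
by rewrite dual_Wtilde_increasing // !divff ?mul1r ?Rf_neq0 ?(Qf_neq0 _ z_adm).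
Qed.

Lemma pairing_orthonormal J : is_part lam J -> orthonormal lam h J.
Proof.
elim/coloring_tperm_ind: J => [J J_incr partJ|J p q pq ltJ IH].
  exact: orthonormal_increasing.
by rewrite is_part_pullback => /IH; apply: orthonormal_tperm.
Qed.

End WeaklyIncreasing.

Theorem theorem6p6 (F : fieldType) (N n : nat) (lam : 'I_N -> nat)
  (Hlam : (\sum_(j < N) lam j)%N = n)
  (z : 'I_n -> F) (h : F)
  (Hz0 : forall i, z i != 0)
  (Hzd : forall i j, i != j -> z i != z j)
  (Hh0 : h != 0)
  (Hhz : forall i j, h * z i != z j)
  (J K : {ffun 'I_n -> 'I_N})
  (HJ : is_part lam J) (HK : is_part lam K) :
  \sum_(I : {ffun 'I_n -> 'I_N} | is_part lam I)
     h ^+ pinv K * Pf I z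
     * (Wt lam 1 J I z h * Wt lam (sigma0 n) K I (fun i => (z i)^-1) h^-1)
     / (Rf I z * Qf I z h)
  = (J == K)%:R.
Proof.
have z_inj : injective z by move=> i j; apply: contra_eq; apply: Hzd.
rewrite -(pairing_orthonormal Hh0 HJ HK (And3 Hz0 z_inj Hhz)).
apply: eq_bigr => M partM; rewrite !Wt_Wtilde // pullback1 pinvE.
rewrite /kernel /dual_Wtilde.
rewrite (eq_Wtilde _ _ _ _ _ (y' := z)) => [|i]; last by rewrite /= perm1.
by ring.
Qed.
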